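(* Let $R$ be a ring and let $\mathcal{E}=(\cdots\to E_{-2}\to E_{-1}\to E_0\to E_1\to E_2\to\cdots)$ be a representation of the quiver $A_\infty^\infty$ by left $R$-modules. Then $\mathcal{E}$ is an injective object of $(A_\infty^\infty,R\text{-Mod})$ if and only if $E_i$ is an injective $R$-module and $E_i\to E_{i+1}$ is a splitting epimorphism for all $i\in\mathbb{Z}$. That is, $A_\infty^\infty$ is a source injective representation quiver.
   Context: Rings are associative with identity, not necessarily commutative. For a quiver $Q$ (possibly infinite, with vertices, arrows, source map $s$ and target map $t$), $(Q,R\text{-Mod})$ is the category of representations of $Q$ by left $R$-modules: a representation assigns a left $R$-module to each vertex and a homomorphism to each arrow; morphisms are natural transformations. $A_\infty^\infty$ is the quiver $\cdots\to\bullet\to\bullet\to\bullet\to\cdots$ with vertex set $\mathbb{Z}$ and exactly one arrow $i\to i+1$ for each $i\in\mathbb{Z}$. A quiver $Q$ is a source injective representation quiver if for every ring $R$ and every $\mathcal{X}\in(Q,R\text{-Mod})$: $\mathcal{X}$ is injective if and only if (i) $\mathcal{X}(v)$ is an injective $R$-module for every vertex $v$ and (ii) for every vertex $v$ the morphism $\mathcal{X}(v)\to\prod_{s(a)=v}\mathcal{X}(t(a))$ induced by the maps $\mathcal{X}(a)$ is a splitting epimorphism. *)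

(* Defs.v *)
(* Modules are MathComp's [lmodType R] over an arbitrary [R : pzRingType]
   (associative with identity, not necessarily commutative, possibly zero).
   [boolp] supplies functional extensionality for infinite products and the
   [choiceType] structure that [lmodType] requires of them. *)
From HB Require Import structures.
From mathcomp Require Import all_boot all_order all_algebra.
From mathcomp Require Import boolp.

Set Implicit Arguments.
Unset Strict Implicit.
Unset Printing Implicit Defensive.

Import GRing.Theory.
Local Open Scope ring_scope.

Definition dprod (R : pzRingType) (I : Type) (M : I -> lmodType R) : Type :=
  forall i, M i.

Section Dprod.
Variables (R : pzRingType) (I : Type) (M : I -> lmodType R).
Implicit Types (x y z : dprod M) (a b : R).

Definition dprod_zero : dprod M := fun=> 0.
Definition dprod_opp x : dprod M := fun i => - x i.
Definition dprod_add x y : dprod M := fun i => x i + y i.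
Definition dprod_scale a x : dprod M := fun i => a *: x i.

Fact dprod_addA : associative dprod_add.
Proof. by move=> x y z; apply: functional_extensionality_dep => i; exact: addrA. Qed.
Fact dprod_addC : commutative dprod_add.
Proof. by move=> x y; apply: functional_extensionality_dep => i; exact: addrC. Qed.
Fact dprod_add0 : left_id dprod_zero dprod_add.
Proof. by move=> x; apply: functional_extensionality_dep => i; exact: add0r. Qed.
Fact dprod_addN : left_inverse dprod_zero dprod_opp dprod_add.
Proof. by move=> x; apply: functional_extensionality_dep => i; exact: addNr. Qed.

HB.instance Definition _ := gen_eqMixin (dprod M).
HB.instance Definition _ := gen_choiceMixin (dprod M).
HB.instance Definition _ := GRing.isZmodule.Build (dprod M)
  dprod_addA dprod_addC dprod_add0 dprod_addN.

Fact dprod_scaleA a b x :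
  dprod_scale a (dprod_scale b x) = dprod_scale (a * b) x.
Proof. by apply: functional_extensionality_dep => i; exact: scalerA. Qed.
Fact dprod_scale1 : left_id 1 dprod_scale.
Proof. by move=> x; apply: functional_extensionality_dep => i; exact: scale1r. Qed.
Fact dprod_scaleDr : right_distributive dprod_scale +%R.
Proof. by move=> a x y; apply: functional_extensionality_dep => i; exact: scalerDr. Qed.
Fact dprod_scaleDl x : {morph dprod_scale^~ x : a b / a + b}.
Proof. by move=> a b; apply: functional_extensionality_dep => i; exact: scalerDl. Qed.

HB.instance Definition _ := GRing.Zmodule_isLmodule.Build R (dprod M)
  dprod_scaleA dprod_scale1 dprod_scaleDr dprod_scaleDl.

End Dprod.

Definition injective_module (R : pzRingType) (E : lmodType R) : Prop :=
  forall (A B : lmodType R) (f : {linear A -> B}) (g : {linear A -> E}),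
    injective f -> exists h : {linear B -> E}, forall x, h (f x) = g x.

Definition split_epi (R : pzRingType) (M N : lmodType R)
    (f : {linear M -> N}) : Prop :=
  exists g : {linear N -> M}, forall y, f (g y) = y.

Record quiver := Quiver {
  vertex : Type;
  arrow : Type;
  source : arrow -> vertex;
  target : arrow -> vertex }.

Record representation (Q : quiver) (R : pzRingType) := Representation {
  rep_obj :> vertex Q -> lmodType R;
  rep_map : forall a : arrow Q,
    {linear rep_obj (source a) -> rep_obj (target a)} }.

Record rep_hom (Q : quiver) (R : pzRingType) (X Y : representation Q R) :=
  RepHom {
    rep_hom_fun :> forall v : vertex Q, {linear X v -> Y v};
    rep_hom_natural : forall (a : arrow Q) (x : X (source a)),
      rep_hom_fun (target a) (rep_map X a x) =
      rep_map Y a (rep_hom_fun (source a) x) }.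

(* Morphisms of representations are compared pointwise. *)
Definition rep_mono (Q : quiver) (R : pzRingType) (X Y : representation Q R)
    (f : rep_hom X Y) : Prop :=
  forall (Z : representation Q R) (u w : rep_hom Z X),
    (forall v z, f v (u v z) = f v (w v z)) -> forall v z, u v z = w v z.

Definition injective_representation (Q : quiver) (R : pzRingType)
    (X : representation Q R) : Prop :=
  forall (A B : representation Q R) (f : rep_hom A B) (g : rep_hom A X),
    rep_mono f -> exists h : rep_hom B X, forall v x, h v (f v x) = g v x.

Definition arrow_from (Q : quiver) (v : vertex Q) : Type :=
  {a : arrow Q | source a = v}.

Section SourceMap.
Variables (Q : quiver) (R : pzRingType) (X : representation Q R).

Fact rep_cast_linear (v w : vertex Q) (e : v = w) :
  linear (fun x : X v => ecast u (X u) e x).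
Proof. by case: w / e. Qed.

Variable v : vertex Q.

Definition source_prod : lmodType R :=
  dprod (fun a : arrow_from v => X (target (sval a))).

(* [X v] is transported to [X (source a)] along [source a = v]. *)
Definition source_map (x : X v) : source_prod :=
  fun a => rep_map X (sval a) (ecast w (X w) (esym (proj2_sig a)) x).

Fact source_map_is_linear : linear source_map.
Proof.
move=> k x y; apply: functional_extensionality_dep => a.
by rewrite /source_map rep_cast_linear linearP.
Qed.

HB.instance Definition _ := GRing.isLinear.Build R (X v) source_prod *:%R
  source_map source_map_is_linear.

End SourceMap.

Definition source_injective_representation_quiver (Q : quiver) : Prop :=
  forall (R : pzRingType) (X : representation Q R),
    injective_representation X <->
    (forall v, injective_module (X v)) /\
    (forall v, split_epi (@source_map Q R X v)).

Definition A_infty_infty : quiver :=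
  @Quiver int int (fun i => i) (fun i => i + 1).

(* Main.v *)
Require Import Defs.
From HB Require Import structures.
From mathcomp Require Import all_boot all_order all_algebra.
From mathcomp Require Import boolp zify.
From Stdlib Require Import Eqdep_dec.

Set Implicit Arguments.
Unset Strict Implicit.
Unset Printing Implicit Defensive.

Import Order.TTheory GRing.Theory Num.Theory.
Local Open Scope ring_scope.

(** A representation [X] of the quiver has transport maps
    [transport X i n : X i -> X n], composites of the structure maps for
    [i <= n] and zero for [n < i].

    Necessity.  The functor [X |-> X i] has a left adjoint [free_rep _ i],
    placing a module at all vertices [n >= i] with identity maps between them.
    It preserves injections, so if [E] is injective every [E i] is injective
    ([injective_rep_obj]).  With [M = E (i + 1)], the identity of [M]
    corresponds to a morphism [free_rep M (i + 1) -> E]; extended along the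
    inclusion [free_rep M (i + 1) -> free_rep M i], it yields at vertex [i] a
    section of [E i -> E (i + 1)] ([injective_rep_split]).  The adjunction also
    shows that monomorphisms are the pointwise injective morphisms.

    Sufficiency.  Let all [E n] be injective and all maps of [E] be split
    epimorphisms, and extend [g : A -> E] along [f : A -> B].  Extensions
    [u n : B n -> E n] of the [g n] exist separately, but need not commute with
    the structure maps.  An element [b] of [B j] therefore only gives a family
    [y n = u n (transport B j n b)] in [family E], the product of all [E n],
    which is a thread (compatible with the maps of [E]) from [j] on when [b]
    comes from [A].  It suffices to find linear maps
    [rho n : family E -> E n], compatible with the maps of [E], such that
    [rho n y = y n] for every [y] that is a thread from [n] on
    ([thread_extend]): then [h j b = rho j y] agrees with [g] on [A], and it
    commutes with the structure maps because passing from [b] to its image in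
    [B (j + 1)] changes [y] only at indices [<= j], and the difference, being a
    zero thread from [j + 1] on, is killed by [rho (j + 1)].

    Below [0], [rho] is built downwards with the sections of the maps of [E];
    above, [rho n] must be the image of [rho 0], and this is the heart of the
    matter.  The sections give lifts [S n : family E -> E 0] with [S n y] above
    [y n] (its image in [E n] is [y n]) and [S (n + 1) y = S n y] when
    [y (n + 1)] is the image of [y n] ([lift_ex]).  The eventual value of
    [S n y] is a linear function on the submodule of the [y] for which [S n y]
    is eventually constant, and the injectivity of [E 0] extends it to all of
    [family E] ([eventual_value_extend]).

    Finally, a single arrow leaves each vertex [v], so [source_map] is the map
    [E v -> E (v + 1)] up to the identification of a product with one factor
    with that factor ([source_map_split]). *)

(** * Linear maps and submodules *)

Section Linear.
Variables (R : pzRingType).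
Implicit Types (U V W : lmodType R).

Definition linear_of U V (f : U -> V) (lf : linear f) : {linear U -> V} :=
  HB.pack f (GRing.isLinear.Build R U V *:%R f lf).

(** The closure proof is a parameter of the type so that the module structure
    can be inferred from it. *)
Definition submodule V (S : {pred V}) (cS : submod_closed S) : Type :=
  {x : V | x \in S}.

HB.instance Definition _ V (S : {pred V}) (cS : submod_closed S) :=
  SubChoice.copy (submodule cS) {x : V | x \in S}.
HB.instance Definition _ V (S : {pred V}) (cS : submod_closed S) :=
  GRing.SubChoice_isSubLmodule.Build R V S (submodule cS) cS.

Fact dprod_proj_linear (I : Type) (M : I -> lmodType R) (i : I) :
  linear (fun y : dprod M => y i).
Proof. by []. Qed.

Definition dprod_proj (I : Type) (M : I -> lmodType R) (i : I) :
  {linear dprod M -> M i} := linear_of (@dprod_proj_linear I M i).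

(** A partially defined linear map presented by its graph: the graph is a
    submodule of the product, its first projection is injective because the
    graph is functional, and the second projection extends along the first.
    This form spares a choice of values on the domain. *)
Lemma injective_module_extend_graph V (E : lmodType R) (G : V -> E -> Prop) :
    injective_module E -> G 0 0 ->
    (forall a v w x y, G v x -> G w y -> G (a *: v + w) (a *: x + y)) ->
    (forall x, G 0 x -> x = 0) ->
  exists h : {linear V -> E}, forall v x, G v x -> h v = x.
Proof.
move=> injE G0 GP Gfun.
pose S : {pred V * E} := fun p => `[< G p.1 p.2 >].
have cS : submod_closed S.
  split; first exact/asboolP.
  move=> a p q /asboolP Gp /asboolP Gq; apply/asboolP; exact: GP.
have lf : linear (fun p : submodule cS => (val p).1) by [].
have lg : linear (fun p : submodule cS => (val p).2) by [].
have finj : injective (linear_of lf).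
  move=> p q /= epq; apply: val_inj; move: epq.
  case: p q => [[v x] /= /asboolP/= Gp] [[w y] /= /asboolP/= Gq] /= evw.
  subst w; congr (_, _).
  have := GP (-1) _ _ _ _ Gp Gq; rewrite !scaleN1r addNr => /Gfun/eqP.
  by rewrite addrC subr_eq0 => /eqP.
have [h hP] := injE _ _ _ (linear_of lg) finj.
exists h => v x Gvx.
have Spx : (v, x) \in S by apply/asboolP.
exact: (hP (exist _ (v, x) Spx)).
Qed.

End Linear.

(** * Induction and recursion along the integers *)

Lemma int_ind_from (P : int -> Prop) (j : int) :
    P j -> (forall n, j <= n -> P n -> P (n + 1)) ->
  forall n, j <= n -> P n.
Proof.
move=> Pj Pstep n le_jn.
have -> : n = j + `|n - j|%N%:Z by lia.
elim: `|n - j|%N => [|k IHk]; first by rewrite addr0.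
have -> : j + k.+1%:Z = j + k%:Z + 1 by lia.
by apply: Pstep => //; lia.
Qed.

(** Dependent choice in both directions from [j].  The choices are iterated on
    pairs of an index and a value, where [n + 1] and [n] need not match
    definitionally; the casts are confined to this proof. *)
Lemma int_chain (P : int -> Type) (Rel : forall n, P n -> P (n + 1) -> Prop)
    (j : int) (p0 : P j) :
    (forall n (p : P n), j <= n -> exists q, Rel n p q) ->
    (forall n (q : P (n + 1)), n < j -> exists p, Rel n p q) ->
  exists2 f : forall n, P n, f j = p0 & forall n, Rel n (f n) (f (n + 1)).
Proof.
move=> up down.
pose T := {n : int & P n}.
pose s0 : T := existT P j p0.
pose RelT (s s' : T) := exists n p q,
  [/\ s = existT P n p, s' = existT P (n + 1) q & Rel n p q].
have upT (s : T) : exists s', j <= tag s -> RelT s s'.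
  case: s => n p; have [le_jn|lt_nj] := leP j n; last first.
    by exists (existT P n p).
  by have [q pq] := up n p le_jn; exists (existT P (n + 1) q) => _;
    exists n, p, q.
have downT (s' : T) : exists s, tag s' <= j -> RelT s s'.
  case: s' => m q; have [n em] : exists n, m = n + 1 by exists (m - 1); lia.
  subst m; have [le_jn|lt_nj] := leP j n.
    by exists s0 => /=; lia.
  by have [p pq] := down n q lt_nj; exists (existT P n p) => _; exists n, p, q.
have [u uP] := choice upT; have [d dP] := choice downT.
pose g (n : int) : T :=
  if j <= n then iter `|n - j|%N u s0 else iter `|n - j|%N d s0.
have tag_step s s' : RelT s s' -> tag s' = tag s + 1.
  by case=> n [p [q [-> ->]]].
have tag_u k : tag (iter k u s0) = j + k%:Z.
  elim: k => [|k IHk] /=; first by rewrite addr0.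
  by rewrite (tag_step _ _ (uP _ _)) IHk //; lia.
have tag_d k : tag (iter k d s0) = j - k%:Z.
  elim: k => [|k IHk] /=; first by rewrite subr0.
  have le_j : tag (iter k d s0) <= j by rewrite IHk; lia.
  by apply: (addIr 1); rewrite -(tag_step _ _ (dP _ le_j)) IHk; lia.
have tag_g n : tag (g n) = n.
  by rewrite /g; case: (leP j n) => le_jn; rewrite ?tag_u ?tag_d; lia.
have gstep n : RelT (g n) (g (n + 1)).
  rewrite /g; have [le_jn|lt_nj] := leP j n.
    have -> : j <= n + 1 by lia.
    have -> : `|(n + 1 - j)%R|%N = `|(n - j)%R|%N.+1 by lia.
    by apply: uP; rewrite tag_u; lia.
  have -> : `|(n - j)%R|%N = `|(n + 1 - j)%R|%N.+1 by lia.
  have [le_jn|_] := leP j (n + 1); last by apply: dP; rewrite tag_d; lia.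
  have -> : `|(n + 1 - j)%R|%N = 0%N by lia.
  exact: dP.
have gj : g j = s0 by rewrite /g lexx subrr.
have gT n : {p : P n | g n = existT P n p}.
  by case: (g n) (tag_g n) => m p /= em; subst m; exists p.
pose f n := sval (gT n).
have gf n : g n = existT P n (f n) by exact: svalP (gT n).
have tagI := @inj_pair2_eq_dec int (@eq_comparable int).
exists f => [|n]; first by apply: tagI; rewrite -gf.
have [m [p [q [ep eq pq]]]] := gstep n.
have em : m = n by rewrite -(tag_g n) ep.
subst m; rewrite gf in ep; rewrite gf in eq.
by rewrite (tagI _ _ _ _ ep) (tagI _ _ _ _ eq).
Qed.

(** * Transport along the quiver *)

Section Transport.
Variable R : pzRingType.
Implicit Types X Y : representation A_infty_infty R.

Definition step X (i : int) : {linear X i -> X (i + 1)} := rep_map X i.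

Lemma rep_hom_step X Y (f : rep_hom X Y) i x :
  f (i + 1) (step X i x) = step Y i (f i x).
Proof. exact: (rep_hom_natural f). Qed.

(** The value zero for [n < i] lets a single family indexed by all integers
    record the orbit of an element of [X i]. *)
Lemma transport_ex X (i : int) :
  exists t : forall n, {linear X i -> X n},
    [/\ forall x, t i x = x,
        forall n x, i <= n -> t (n + 1) x = step X n (t n x)
      & forall n x, n < i -> t n x = 0].
Proof.
pose P n := {p : {linear X i -> X n} | n < i -> forall x, p x = 0}.
pose Rel n (p : P n) (q : P (n + 1)) :=
  i <= n -> forall x, sval q x = step X n (sval p x).
have id_ok : i < i -> forall x, (idfun : {linear X i -> X i}) x = 0.
  by rewrite ltxx.
have up n (p : P n) : i <= n -> exists q, Rel n p q.
  case: p => p p0 le_in; pose q : {linear X i -> X (n + 1)} := step X n \o p.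
  have q0 : n + 1 < i -> forall x, q x = 0 by lia.
  by exists (exist _ q q0).
have down n (q : P (n + 1)) : n < i -> exists p, Rel n p q.
  move=> lt_ni.
  have p0 : n < i -> forall x, (\0 : {linear X i -> X n}) x = 0 by [].
  by exists (exist _ _ p0) => /(lt_le_trans lt_ni); rewrite ltxx.
have [t ti tRel] := int_chain (exist _ _ id_ok : P i) up down.
exists (fun n => sval (t n)); split=> [x|n x le_in|n x lt_ni].
- by rewrite ti.
- exact: tRel.
- exact: (svalP (t n)).
Qed.

Definition transport X i : forall n, {linear X i -> X n} :=
  sval (cid (transport_ex X i)).

Lemma transport_id X i x : transport X i i x = x.
Proof. by rewrite /transport; case: cid => t []. Qed.

Lemma transport_step X i n x : i <= n ->
  transport X i (n + 1) x = step X n (transport X i n x).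
Proof. by rewrite /transport; case: cid => t [/= _ ts _]; apply: ts. Qed.

Lemma transport_lt X i n x : n < i -> transport X i n x = 0.
Proof. by rewrite /transport; case: cid => t [/= _ _]; apply. Qed.

(** At [n = i] the two sides differ: the left one is zero there. *)
Lemma transport_step_source X i n x : i < n ->
  transport X (i + 1) n (step X i x) = transport X i n x.
Proof.
move=> lt_in; have le_n : i + 1 <= n by lia.
elim/int_ind_from: n / le_n {lt_in} => [|n le_n IHn].
  by rewrite transport_id transport_step // transport_id.
by rewrite !transport_step ?IHn //; lia.
Qed.

Lemma rep_hom_transport X Y (f : rep_hom X Y) i n x :
  f n (transport X i n x) = transport Y i n (f i x).
Proof.
have [le_in|lt_ni] := leP i n; last by rewrite !transport_lt ?linear0.
elim/int_ind_from: n / le_in => [|n le_in IHn]; first by rewrite !transport_id.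
by rewrite !transport_step ?rep_hom_step ?IHn.
Qed.

End Transport.

(** * Free representations *)

Section Free.
Variable R : pzRingType.
Implicit Types (M N : lmodType R) (X Y : representation A_infty_infty R).

(** At a vertex [n] the free representation is the submodule of [M] that is
    everything for [i <= n] and zero otherwise.  Using submodules of a fixed
    module makes all structure maps restrictions of the identity. *)
Definition free_support M (i n : int) : {pred M} :=
  fun x => (i <= n) || (x == 0).

Lemma free_support_closed M i n : submod_closed (@free_support M i n).
Proof.
rewrite /free_support; split=> [|a x y]; rewrite !unfold_in ?eqxx ?orbT //.
case: (i <= n) => //= /eqP-> /eqP->.
by rewrite scaler0 addr0.
Qed.

Definition free_obj M i n : lmodType R :=
  submodule (@free_support_closed M i n).

Lemma free_support_le M N (f : {linear M -> N}) i j m n (x : free_obj M i m) :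
  j <= i -> m <= n -> f (val x) \in @free_support N j n.
Proof.
move=> le_ji le_mn; case: x => x /=; rewrite /free_support !unfold_in.
case/orP=> [le_im|/eqP->]; last by rewrite linear0 eqxx orbT.
by rewrite (le_trans le_ji (le_trans le_im le_mn)).
Qed.

(** One construction serves for the structure maps ([i = j], [f] the identity)
    and for the morphisms between free representations ([m = n]). *)
Definition free_fun M N (f : {linear M -> N}) i j m n (le_ji : j <= i)
  (le_mn : m <= n) (x : free_obj M i m) : free_obj N j n :=
  exist _ (f (val x)) (free_support_le f x le_ji le_mn).

Fact free_fun_linear M N (f : {linear M -> N}) i j m n
  (le_ji : j <= i) (le_mn : m <= n) : linear (free_fun f le_ji le_mn).
Proof. by move=> a x y; apply: val_inj; rewrite /= linearP. Qed.

Lemma le_succ (n : int) : n <= n + 1. Proof. lia. Qed.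

Definition free_rep M i : representation A_infty_infty R :=
  @Representation A_infty_infty R (free_obj M i)
    (fun n => linear_of (free_fun_linear (idfun : {linear M -> M})
                (lexx i) (le_succ n))).

Fact free_map_natural M N (f : {linear M -> N}) i j (le_ji : j <= i)
    (n : int) (x : free_rep M i n) :
  free_fun f le_ji (lexx (n + 1)) (step (free_rep M i) n x) =
  step (free_rep N j) n (free_fun f le_ji (lexx n) x).
Proof. exact: val_inj. Qed.

Definition free_map M N (f : {linear M -> N}) i j (le_ji : j <= i) :
  rep_hom (free_rep M i) (free_rep N j) :=
  @RepHom A_infty_infty R (free_rep M i) (free_rep N j)
    (fun n => linear_of (free_fun_linear f le_ji (lexx n)))
    (free_map_natural f le_ji).

Fact free_lift_linear M X i (f : {linear M -> X i}) n :
  linear (fun x : free_rep M i n => transport X i n (f (val x))).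
Proof. by move=> a x y; rewrite /= !linearP. Qed.

Fact free_lift_natural M X i (f : {linear M -> X i}) n (x : free_rep M i n) :
  transport X i (n + 1) (f (val (step (free_rep M i) n x))) =
  step X n (transport X i n (f (val x))).
Proof.
case: x => x /=; rewrite unfold_in => /orP[le_in|/eqP->].
  exact: transport_step.
by rewrite !linear0.
Qed.

(** The adjunct of [f]. *)
Definition free_lift M X i (f : {linear M -> X i}) : rep_hom (free_rep M i) X :=
  @RepHom A_infty_infty R (free_rep M i) X
    (fun n => linear_of (@free_lift_linear M X i f n)) (free_lift_natural f).

Lemma free_support_id M i n (x : M) : i <= n -> x \in @free_support M i n.
Proof. by move=> le_in; rewrite unfold_in /free_support le_in. Qed.

Definition free_gen M i n (le_in : i <= n) (x : M) : free_rep M i n :=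
  exist _ x (free_support_id x le_in).

Fact free_gen_linear M i n (le_in : i <= n) : linear (@free_gen M i n le_in).
Proof. by move=> a x y; apply: val_inj. Qed.

Lemma free_map_mono M N (f : {linear M -> N}) i j (le_ji : j <= i) :
  injective f -> rep_mono (free_map f le_ji).
Proof.
move=> finj Z u w fuw n z; apply: val_inj; apply: finj.
exact: (congr1 val (fuw n z)).
Qed.

(** An element of the kernel at [i] gives a morphism from [free_rep R^o i] that
    composes with [f] to zero, hence is zero, and takes [1] to that element. *)
Lemma rep_mono_injective X Y (f : rep_hom X Y) : rep_mono f ->
  forall i, injective (f i).
Proof.
move=> fmono i; apply: raddf_inj => x fx0.
have lx : linear (fun r : R^o => r *: x).
  by move=> a r s; rewrite /= scalerDl scalerA.
have l0 : linear (fun r : R^o => 0 : X i).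
  by move=> a r s; rewrite scaler0 addr0.
have := fmono _ (free_lift (linear_of lx)) (free_lift (linear_of l0)) _ i
  (@free_gen R^o i i (lexx i) (1 : R)).
rewrite /= !transport_id scale1r; apply=> n z /=.
by rewrite !rep_hom_transport linearZ /= fx0 scaler0 !linear0.
Qed.

Section Injective.
Variable E : representation A_infty_infty R.
Hypothesis injE : injective_representation E.

Lemma injective_rep_obj i : injective_module (E i).
Proof.
move=> A B f g finj.
have [h hP] := injE (free_lift g) (@free_map_mono _ _ f i i (lexx i) finj).
pose gen : {linear B -> free_rep B i i} :=
  linear_of (@free_gen_linear B i i (lexx i)).
exists (h i \o gen) => x /=.
have /= := hP i (free_gen (lexx i) x); rewrite transport_id => <-.
by congr (h i _); apply: val_inj.
Qed.

(** Extending along [free_rep M (i + 1) -> free_rep M i] pulls the element [y]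
    at vertex [i + 1] back to an element at vertex [i], mapped by [h] to a
    preimage of [y]. *)
Lemma injective_rep_split i : split_epi (step E i).
Proof.
pose M := E (i + 1).
have [h hP] := injE (free_lift (idfun : {linear M -> M}))
  (@free_map_mono M M idfun _ _ (le_succ i) (fun x y => id)).
pose gen : {linear M -> free_rep M i i} :=
  linear_of (@free_gen_linear M i i (lexx i)).
exists (h i \o gen) => y /=.
have /= := hP (i + 1) (free_gen (lexx (i + 1)) y); rewrite transport_id => hy.
by rewrite -[RHS]hy -rep_hom_step; congr (h (i + 1) _); apply: val_inj.
Qed.

End Injective.
End Free.

(** * Extending threads *)

Section Thread.
Variables (R : pzRingType) (E : representation A_infty_infty R).
Hypothesis injE : forall i, injective_module (E i).
Hypothesis splitE : forall i, split_epi (step E i).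

Definition family : lmodType R := dprod (fun n : int => E n).

Definition coord n : {linear family -> E n} :=
  dprod_proj (fun n : int => E n) n.

Definition thread_from (j : int) (y : family) : Prop :=
  forall n, j <= n -> y (n + 1) = step E n (y n).

Lemma transport_split_epi i n : i <= n -> split_epi (transport E i n).
Proof.
elim/int_ind_from: n / => [|n le_in [s sP]].
  by exists idfun => y; rewrite /= transport_id.
have [r rP] := splitE n; exists (s \o r) => y /=.
by rewrite transport_step // sP rP.
Qed.

(** The lifts start from [S i y = y i] and satisfy
    [S (n + 1) y = S n y + s (y (n + 1) - step E n (y n))] with [s] a section
    of [transport E i (n + 1)]: the correction vanishes exactly when [y] is
    compatible at [n]. *)
Lemma lift_ex i : exists S : forall n : int, {linear family -> E i},
  forall n, i <= n -> forall y,
    transport E i n (S n y) = y n /\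
    (y (n + 1) = step E n (y n) -> S (n + 1) y = S n y).
Proof.
pose P (n : int) := {S : {linear family -> E i} |
  i <= n -> forall y, transport E i n (S y) = y n}.
pose Rel n (S : P n) (S' : P (n + 1)) := i <= n -> forall y : family,
  y (n + 1) = step E n (y n) -> sval S' y = sval S y.
have base_ok : i <= i -> forall y, transport E i i (coord i y) = y i.
  by move=> _ y; rewrite transport_id.
have up n (S : P n) : i <= n -> exists S', Rel n S S'.
  case: S => S SP le_in.
  have [|s sP] := @transport_split_epi i (n + 1); first lia.
  pose S' : {linear family -> E i} :=
    S \+ (s \o (coord (n + 1) \- (step E n \o coord n))).
  have S'P : i <= n + 1 -> forall y,
      transport E i (n + 1) (S' y) = y (n + 1).
    by move=> _ y; rewrite /= linearD /= sP transport_step // SP // subrKC.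
  exists (exist _ _ S'P) => _ y /= ->.
  by rewrite subrr linear0 addr0.
have down n (S' : P (n + 1)) : n < i -> exists S, Rel n S S'.
  move=> lt_ni.
  have S0 : i <= n -> forall y, transport E i n (sval S' y) = y n by lia.
  by exists (exist _ _ S0).
have [S _ SP] := int_chain (exist _ _ base_ok : P i) up down.
exists (fun n => sval (S n)) => n le_in y; split.
  exact: (svalP (S n)).
exact: SP.
Qed.

(** The analogue of a Banach limit: eventual constancy defines a submodule on
    which the limit is linear, and injectivity of the target extends it. *)
Lemma eventual_value_extend (B M : lmodType R) (S : int -> {linear B -> M}) :
    injective_module M ->
  exists rho : {linear B -> M},
    forall b x j, (forall n, j <= n -> S n b = x) -> rho b = x.
Proof.
move=> injM.
pose G b x := exists j, forall n, j <= n -> S n b = x.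
have [||| rho rhoP] := injective_module_extend_graph (G := G) injM.
- by exists 0 => n _; rewrite linear0.
- move=> a v w x y [j vx] [k wy]; exists (Num.max j k) => n.
  by rewrite ge_max => /andP[le_jn le_kn]; rewrite linearP vx ?wy.
- by move=> x [j /(_ j (lexx j)) <-]; rewrite linear0.
by exists rho => b x j bx; apply: rhoP; exists j.
Qed.

(** For a thread from [j] on, the lifts [S n y] are constant for [n >= j], so
    the extended eventual value is [S j y], which lies above [y j]. *)
Lemma thread_extend_base i : exists rho : {linear family -> E i},
  forall j y, i <= j -> thread_from j y -> transport E i j (rho y) = y j.
Proof.
have [S SP] := lift_ex i.
have [rho rhoP] := eventual_value_extend S (@injE i).
exists rho => j y le_ij yj.
have -> : rho y = S j y.
  apply: (rhoP _ _ j) => n; elim/int_ind_from: n / => // n le_jn <-.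
  by have [_ ->] := SP n (le_trans le_ij le_jn) y; last exact: yj.
exact: (SP j le_ij y).1.
Qed.

(** The condition carried along the recursion is stronger than the conclusion:
    it concerns threads from every [j >= n] on, so that it passes from [n] to
    [n + 1]. *)
Lemma thread_extend : exists rho : forall n, {linear family -> E n},
  (forall n y, rho (n + 1) y = step E n (rho n y)) /\
  (forall n y, thread_from n y -> rho n y = y n).
Proof.
pose P n := {p : {linear family -> E n} |
  forall j y, n <= j -> thread_from j y -> transport E n j (p y) = y j}.
pose Rel n (p : P n) (q : P (n + 1)) :=
  forall y, sval q y = step E n (sval p y).
have [rho0 rho0P] := thread_extend_base 0.
have up n (p : P n) : 0 <= n -> exists q, Rel n p q.
  case: p => p pP _; pose q : {linear family -> E (n + 1)} := step E n \o p.
  have qP j y : n + 1 <= j -> thread_from j y ->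
      transport E (n + 1) j (q y) = y j.
    by move=> le_j yj; rewrite transport_step_source ?pP //; lia.
  by exists (exist _ q qP).
have down n (q : P (n + 1)) : n < 0 -> exists p, Rel n p q.
  case: q => q qP _; have [s sP] := splitE n.
  (* [s (q y)] lies above [q y]; the other term lies in the kernel of the map to
     [E (n + 1)] and corrects the value to [y n] when [q y] is the image of
     [y n]. *)
  pose p : {linear family -> E n} :=
    (s \o q) \+ (coord n \- (s \o (step E n \o coord n))).
  have step_p y : step E n (p y) = q y.
    by rewrite /= linearD linearB /= !sP subrr addr0.
  have pP j y : n <= j -> thread_from j y ->
      transport E n j (p y) = y j.
    rewrite le_eqVlt => /predU1P[<- yn|lt_nj yj]; last first.
      by rewrite -transport_step_source // step_p qP //; lia.
    have : transport E (n + 1) (n + 1) (q y) = y (n + 1).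
      by apply: qP => // m le_m; apply: yn; lia.
    by rewrite !transport_id => /= ->; rewrite yn // addrC subrK.
  by exists (exist _ _ pP) => y; apply/esym/step_p.
have [rho _ rhoR] := int_chain (exist _ _ rho0P : P 0) up down.
exists (fun n => sval (rho n)); split=> [|n y yn]; first exact: rhoR.
by have := svalP (rho n) n y (lexx n) yn; rewrite transport_id.
Qed.

Lemma injective_rep_of_split : injective_representation E.
Proof.
move=> A B f g /rep_mono_injective finj.
have [u uP] : exists u : forall n, {linear B n -> E n},
    forall n x, u n (f n x) = g n x.
  have ex n := cid (@injE n _ _ (f n) (g n) (finj n)).
  by exists (fun n => sval (ex n)) => n; apply: (svalP (ex n)).
have [rho [rho_step rho_thread]] := thread_extend.
pose y j (b : B j) : family := fun n => u n (transport B j n b).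
have ly j : linear (@y j).
  move=> a b c; apply: functional_extensionality_dep => n.
  by rewrite /y !linearP.
pose h j : {linear B j -> E j} := rho j \o linear_of (ly j).
have h_nat j b : h (j + 1) (step B j b) = step E j (h j b).
  rewrite /= -rho_step; apply/eqP; rewrite -subr_eq0 -linearB; apply/eqP.
  (* The two orbits of [b] differ at the indices [n <= j] only. *)
  set z := y _ _ - y _ _.
  have z0 n : j < n -> z n = 0.
    by move=> lt_jn; rewrite -[LHS]/(y _ _ n - y _ _ n) /y
      transport_step_source // subrr.
  rewrite rho_thread ?z0 //; first lia.
  by move=> n le_n; rewrite !z0 ?linear0 //; lia.
exists (@RepHom A_infty_infty R B E h h_nat) => j a /=.
have yE n : y j (f j a) n = transport E j n (g j a).
  by rewrite /y -rep_hom_transport uP rep_hom_transport.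
rewrite rho_thread ?yE ?transport_id // => n le_jn.
by rewrite !yE transport_step.
Qed.

End Thread.

(** * The maps out of a vertex *)

Section SourceMap.
Variables (R : pzRingType) (X : representation A_infty_infty R) (v : int).

Fact target_cast_linear (w : int) (e : v = w) :
  linear (fun x : X (v + 1) => ecast u (X (u + 1)) e x).
Proof. by case: w / e. Qed.

(** The only arrow out of [v] is [v] itself, so a family over these arrows is
    determined by its component [a0]; conversely [d] spreads a value over all
    arrows equal to [v]. *)
Lemma source_map_split : split_epi (@source_map A_infty_infty R X v) <->
  split_epi (step X v).
Proof.
pose a0 : @arrow_from A_infty_infty v := exist _ v erefl.
pose M (a : @arrow_from A_infty_infty v) := X (sval a + 1).
split=> [[s sP]|[s sP]].
- pose d (x : X (v + 1)) : source_prod X v :=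
    fun a => ecast w (X (w + 1)) (esym (proj2_sig a)) x.
  have ld : linear d.
    move=> k x y; apply: functional_extensionality_dep => a.
    exact: target_cast_linear.
  exists (s \o linear_of ld) => x /=.
  exact: (congr1 (fun z : source_prod X v => z a0) (sP (d x))).
- exists (s \o (dprod_proj M a0 : {linear source_prod X v -> X (v + 1)})) => z.
  apply: functional_extensionality_dep => -[w e].
  case: v / e @a0 @M s sP z => a0 M s sP z.
  exact: sP.
Qed.

End SourceMap.

Theorem corollary5p4 :
  (forall (R : pzRingType) (E : representation A_infty_infty R),
     injective_representation E <->
     (forall i : int, injective_module (E i) /\ split_epi (rep_map E i))) /\
  source_injective_representation_quiver A_infty_infty.
Proof.
have inj_iff (R : pzRingType) (E : representation A_infty_infty R) :
    injective_representation E <->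
    (forall i : int, injective_module (E i) /\ split_epi (rep_map E i)).
  split=> [injE i|E_ok].
    by split; [exact: injective_rep_obj | exact: injective_rep_split].
  by apply: injective_rep_of_split => i; have [] := E_ok i.
split=> [//|R E]; rewrite inj_iff; split=> [E_ok|[injE splitE] i].
  split=> v; first exact: (E_ok v).1.
  exact/source_map_split/(E_ok v).2.
by split; [exact: injE | exact/source_map_split/splitE].
Qed.
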